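(* Let $\mu$ be a Boolean compound Poisson distribution over $\mathcal B$, and let $\alpha:\mathcal B\to\mathcal B$ be a completely positive map of the special form $\alpha[b]=(1+e)\,b\,(1+e^* )$ for some $e\in\mathcal B$. Let $(\mathcal M=\mathcal B\oplus\mathcal M_0,\mathbb E,\mathcal B)$ be a $\mathcal B$-valued noncommutative probability space, let $Y\in\mathcal M_0$ be self-adjoint with $M_Y=B_\mu$, and let $Q\in\mathcal M_0$ be Boolean independent from $Y$ over $\mathcal B$ and such that $\mathbb E(Q)=e$ and $\mathrm{Var}_Q(b)=b$ for all $b\in\mathcal B$, where $$\mathrm{Var}_Q(b)=\mathbb E\bigl((1+Q^* )b(1+Q)\bigr)-\mathbb E(1+Q^* )\,b\,\mathbb E(1+Q).$$ Let $$T=(1+Q)Y(1+Q^* ).$$ Then the distribution of $T$ is $\mu^{\uplus\alpha}$.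
   Context: $\mathcal B$ is a fixed unital $C^*$-algebra. Distributions. $\mathcal B\langle \mathcal X\rangle$ is the $*$-algebra of polynomials in a self-adjoint formal variable $\mathcal X$ with coefficients in $\mathcal B$, where $\mathcal X$ and $\mathcal B$ are algebraically independent: as a vector space it is $\bigoplus_{n\ge 0}$ of the spans of the monomials $b_0\mathcal X b_1\cdots \mathcal X b_n$, the $n$-th span being isomorphic to $\mathcal B^{\otimes_{\mathbb C}(n+1)}$. $\Sigma_{alg}(\mathcal B)$ is the set of all $\mathbb C$-linear $\mathcal B$-bimodule maps $\mu:\mathcal B\langle\mathcal X\rangle\to\mathcal B$ with $\mu[b]=b$ for $b\in\mathcal B$; $\Sigma(\mathcal B)$ is the subset of positive ones ($\mu[P^*P]\ge0$). A $\mathcal B$-valued noncommutative probability space $(\mathcal M,\mathbb E,\mathcal B)$ consists of a unital $*$-algebra $\mathcal M\supseteq\mathcal B$ and a unital positive $\mathcal B$-bimodule map $\mathbb E:\mathcal M\to\mathcal B$. Here $\mathcal M=\mathcal B\oplus\mathcal M_0$ with multiplication $(b_1,m_1)(b_2,m_2)=(b_1b_2,\,b_1m_2+m_1b_2+m_1m_2)$. The distribution of a self-adjoint $Z\in\mathcal M$ is $\mu_Z[b_0\mathcal Xb_1\cdots\mathcal Xb_n]=\mathbb E[b_0Zb_1\cdots Zb_n]$. Boolean independence. Subalgebras $\mathcal M_1,\dots,\mathcal M_k\subset\mathcal M_0$ are Boolean independent over $\mathcal B$ if, whenever $j(i)\ne j(i+1)$ for all $i$, $X_i\in\mathcal M_{j(i)}$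 for $i\ne1,n$, $X_i\in\mathcal B\oplus\mathcal M_{j(i)}$ for $i=1,n$, and $b_0,\dots,b_n\in\mathcal B$, one has $\mathbb E[b_0X_1b_1X_2\cdots X_nb_n]=b_0\mathbb E[X_1]b_1\mathbb E[X_2]\cdots\mathbb E[X_n]b_n$. Elements of $\mathcal M_0$ are Boolean independent if the $*$-subalgebras of $\mathcal M_0$ they generate over $\mathcal B$ are. Series. $\mathrm{Ser}(\mathcal B)$ is the set of sequences $F=(F^{[n]})_{n\ge1}$ with $F^{[1]}\in\mathcal B$ and $F^{[n]}:\mathcal B^{n-1}\to\mathcal B$ $\mathbb C$-multilinear; $(\alpha\circ F)^{[n]}:=\alpha\circ F^{[n]}$. The moment series is $M_\mu^{[1]}=\mu[\mathcal X]$, $M_\mu^{[n]}(b_1,\dots,b_{n-1})=\mu[\mathcal Xb_1\mathcal X\cdots b_{n-1}\mathcal X]$, and $M_Z:=M_{\mu_Z}$. The $B$-transform $B_\mu$ of $\mu\in\Sigma_{alg}(\mathcal B)$ is the unique series with $$M_\mu^{[n]}(b_1,\dots,b_{n-1})=\sum_{k=1}^n\ \sum_{0=q_0<q_1<\cdots<q_k=n}B_\mu^{[q_1-q_0]}(b_{q_0+1},\dots,b_{q_1-1})\,b_{q_1}\,B_\mu^{[q_2-q_1]}(b_{q_1+1},\dots,b_{q_2-1})\,b_{q_2}\cdots b_{q_{k-1}}B_\mu^{[q_k-q_{k-1}]}(b_{q_{k-1}+1},\dots,b_{q_k-1})$$ for all $n\ge1$; $\mu\mapsto B_\mu$ is a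 bijection $\Sigma_{alg}(\mathcal B)\to\mathrm{Ser}(\mathcal B)$. $\mu^{\uplus\alpha}\in\Sigma_{alg}(\mathcal B)$ is determined by $B_{\mu^{\uplus\alpha}}=\alpha\circ B_\mu$. $\mu$ is a (generalized) Boolean compound Poisson distribution if there are $\nu\in\Sigma(\mathcal B)$ and a completely positive linear map $\kappa:\mathcal B\to\mathcal B$ with $B_\mu^{[n]}(b_1,\dots,b_{n-1})=\kappa\bigl[M_\nu^{[n]}(b_1,\dots,b_{n-1})\bigr]$ for all $n\ge1$. *)

(* Defs.v *)
From HB Require Import structures.
From mathcomp Require Import all_boot all_order all_algebra.
From mathcomp Require Import boolp classical_sets reals.
From mathcomp Require Import complex.
From mathcomp Require Import zify.

Set Implicit Arguments.
Unset Strict Implicit.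
Unset Printing Implicit Defensive.

Import Order.TTheory GRing.Theory Num.Theory.

Local Open Scope ring_scope.

HB.mixin Record isStarAlgebra (K : numClosedFieldType) A & GRing.Algebra K A := {
  star : A -> A;
  starK : involutive star;
  starD : {morph star : x y / x + y};
  starM : forall x y, star (x * y) = star y * star x;
  starZ : forall (a : K) x, star (a *: x) = Num.conj a *: star x
}.

#[short(type="starAlgType")]
HB.structure Definition StarAlgebra (K : numClosedFieldType) :=
  {A of GRing.Algebra K A & isStarAlgebra K A}.

(* The norm is part of the mixin because Hierarchy-Builder rejects the join of
   [completeNormedModType] with a ring structure (the two only meet in
   [numDomainType]). *)
HB.mixin Record isCStarAlgebra (R : realType) A & StarAlgebra R[i] A := {
  cnorm : A -> R;
  cnorm_eq0 : forall x, cnorm x = 0 -> x = 0;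
  cnormD : forall x y, cnorm (x + y) <= cnorm x + cnorm y;
  cnormZ : forall (a : R[i]) x, (cnorm (a *: x))%:C%C = `|a| * (cnorm x)%:C%C;
  cnormM : forall x y : A, cnorm (x * y) <= cnorm x * cnorm y;
  cnorm_star : forall x : A, cnorm (star x * x) = cnorm x ^+ 2;
  cnorm_complete : forall u : nat -> A,
    (forall eps : R, 0 < eps -> exists N : nat, forall m n : nat,
       (N <= m)%N -> (N <= n)%N -> cnorm (u m - u n) < eps) ->
    exists l : A, forall eps : R, 0 < eps -> exists N : nat, forall n : nat,
      (N <= n)%N -> cnorm (u n - l) < eps
}.

#[short(type="cstarAlgType")]
HB.structure Definition CStarAlgebra (R : realType) :=
  {A of StarAlgebra R[i] A & isCStarAlgebra R A}.

Section Positivity.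
Variables (K : numClosedFieldType) (B : starAlgType K).

Lemma star0 : star (0 : B) = 0.
Proof. by rewrite -[X in star X](scale0r (0 : B)) starZ rmorph0 scale0r. Qed.

Lemma star1 : star (1 : B) = 1.
Proof. by rewrite -[LHS]mulr1 -{2}[1]starK -starM mulr1 starK. Qed.

Lemma starN (x : B) : star (- x) = - star x.
Proof. by rewrite -scaleN1r starZ rmorphN rmorph1 scaleN1r. Qed.

(* In a C*-algebra, and in the C*-algebra of matrices over one, the positive
   elements are the c^* c. *)
Definition nonneg (x : B) := exists c : B, x = star c * c.

Definition mx_star n (A : 'M[B]_n) : 'M[B]_n := (map_mx star A)^T.

Definition mx_nonneg n (A : 'M[B]_n) := exists C : 'M[B]_n, A = mx_star C *m C.

Definition completely_positive (f : B -> B) :=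
  forall n (A : 'M[B]_n), mx_nonneg A -> mx_nonneg (map_mx f A).

End Positivity.

Section Polynomials.
Variables (K : numClosedFieldType) (B : starAlgType K).

Inductive pterm : Type :=
| PConst of B
| PVar
| PAdd of pterm & pterm
| PMul of pterm & pterm.

(* The congruence presenting the K-algebra freely generated by the K-algebra B
   and one more element. Multiplication by the scalar a is multiplication by
   the constant a *: 1. *)
Inductive peqv : pterm -> pterm -> Prop :=
| peqv_refl p : peqv p p
| peqv_sym p q : peqv p q -> peqv q p
| peqv_trans q p r : peqv p q -> peqv q r -> peqv p r
| peqv_add p p' q q' : peqv p p' -> peqv q q' -> peqv (PAdd p q) (PAdd p' q')
| peqv_mul p p' q q' : peqv p p' -> peqv q q' -> peqv (PMul p q) (PMul p' q')
| peqv_addA p q r : peqv (PAdd p (PAdd q r)) (PAdd (PAdd p q) r)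
| peqv_addC p q : peqv (PAdd p q) (PAdd q p)
| peqv_add0 p : peqv (PAdd (PConst 0) p) p
| peqv_mulA p q r : peqv (PMul p (PMul q r)) (PMul (PMul p q) r)
| peqv_mul1 p : peqv (PMul (PConst 1) p) p
| peqv_mulr1 p : peqv (PMul p (PConst 1)) p
| peqv_mul0 p : peqv (PMul (PConst 0) p) (PConst 0)
| peqv_mulDl p q r : peqv (PMul (PAdd p q) r) (PAdd (PMul p r) (PMul q r))
| peqv_mulDr p q r : peqv (PMul p (PAdd q r)) (PAdd (PMul p q) (PMul p r))
| peqv_constD b c : peqv (PConst (b + c)) (PAdd (PConst b) (PConst c))
| peqv_constM b c : peqv (PConst (b * c)) (PMul (PConst b) (PConst c))
| peqv_scaleC (a : K) p : peqv (PMul (PConst a%:A) p) (PMul p (PConst a%:A)).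

HB.instance Definition _ := gen_eqMixin pterm.
HB.instance Definition _ := gen_choiceMixin pterm.

Definition peqvb (p q : pterm) : bool := `[< peqv p q >].

Lemma peqvb_refl : reflexive peqvb.
Proof. by move=> p; apply/asboolP; exact: peqv_refl. Qed.

Lemma peqvb_sym : symmetric peqvb.
Proof. by move=> p q; apply/asboolP/asboolP; exact: peqv_sym. Qed.

Lemma peqvb_trans : transitive peqvb.
Proof. by move=> q p r /asboolP pq /asboolP qr; apply/asboolP; exact: peqv_trans qr. Qed.

Canonical peqv_equiv := EquivRel peqvb peqvb_refl peqvb_sym peqvb_trans.

Definition bpoly : Type := {eq_quot peqvb}%qT.
HB.instance Definition _ := Choice.on bpoly.
HB.instance Definition _ : EqQuotient _ peqvb bpoly := EqQuotient.on bpoly.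

Definition ppi (p : pterm) : bpoly := (\pi_bpoly p)%qT.

Lemma ppiP p q : ppi p = ppi q <-> peqv p q.
Proof.
split=> [/eqquotP|] /=; first by move/asboolP.
by move=> h; apply/eqquotP/asboolP.
Qed.

Lemma ppiE (x : bpoly) : exists p, x = ppi p.
Proof. by exists (repr x); rewrite /ppi reprK. Qed.

Lemma ppi_repr p : peqv (repr (ppi p)) p.
Proof. by apply/ppiP; rewrite {1}/ppi reprK. Qed.

Definition bC (b : B) : bpoly := ppi (PConst b).
Definition bX : bpoly := ppi PVar.
Definition badd (x y : bpoly) := ppi (PAdd (repr x) (repr y)).
Definition bmul (x y : bpoly) := ppi (PMul (repr x) (repr y)).
Definition bopp (x : bpoly) := bmul (bC (- 1)) x.

Lemma baddE p q : badd (ppi p) (ppi q) = ppi (PAdd p q).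
Proof. by apply/ppiP/peqv_add; exact: ppi_repr. Qed.

Lemma bmulE p q : bmul (ppi p) (ppi q) = ppi (PMul p q).
Proof. by apply/ppiP/peqv_mul; exact: ppi_repr. Qed.

Lemma baddA : associative badd.
Proof.
move=> x y z; have [[p ->] [q ->] [r ->]] := And3 (ppiE x) (ppiE y) (ppiE z).
by rewrite !baddE; apply/ppiP/peqv_addA.
Qed.

Lemma baddC : commutative badd.
Proof.
move=> x y; have [[p ->] [q ->]] := conj (ppiE x) (ppiE y).
by rewrite !baddE; apply/ppiP/peqv_addC.
Qed.

Lemma badd0 : left_id (bC 0) badd.
Proof.
by move=> x; have [p ->] := ppiE x; rewrite /bC baddE; apply/ppiP/peqv_add0.
Qed.

Lemma bmulA : associative bmul.
Proof.
move=> x y z; have [[p ->] [q ->] [r ->]] := And3 (ppiE x) (ppiE y) (ppiE z).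
by rewrite !bmulE; apply/ppiP/peqv_mulA.
Qed.

Lemma bmul1 : left_id (bC 1) bmul.
Proof.
by move=> x; have [p ->] := ppiE x; rewrite /bC bmulE; apply/ppiP/peqv_mul1.
Qed.

Lemma bmulr1 : right_id (bC 1) bmul.
Proof.
by move=> x; have [p ->] := ppiE x; rewrite /bC bmulE; apply/ppiP/peqv_mulr1.
Qed.

Lemma bmulDl : left_distributive bmul badd.
Proof.
move=> x y z; have [[p ->] [q ->] [r ->]] := And3 (ppiE x) (ppiE y) (ppiE z).
by rewrite !(baddE, bmulE); apply/ppiP/peqv_mulDl.
Qed.

Lemma bmulDr : right_distributive bmul badd.
Proof.
move=> x y z; have [[p ->] [q ->] [r ->]] := And3 (ppiE x) (ppiE y) (ppiE z).
by rewrite !(baddE, bmulE); apply/ppiP/peqv_mulDr.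
Qed.

Lemma baddN : left_inverse (bC 0) bopp badd.
Proof.
move=> x; have [p ->] := ppiE x; rewrite /bopp -{2}[ppi p]bmul1 -bmulDl.
rewrite /bC baddE bmulE; apply/ppiP.
apply: (peqv_trans _ (peqv_mul0 p)); apply: peqv_mul (peqv_refl _).
by rewrite -(addNr 1); exact/peqv_sym/peqv_constD.
Qed.

HB.instance Definition _ := GRing.isZmodule.Build bpoly baddA baddC badd0 baddN.

(* Substituting 0 for X; only used to see that 1 != 0. *)
Fixpoint pterm_at0 (p : pterm) : B :=
  match p with
  | PConst b => b
  | PVar => 0
  | PAdd p q => pterm_at0 p + pterm_at0 q
  | PMul p q => pterm_at0 p * pterm_at0 q
  end.

Lemma pterm_at0_eqv p q : peqv p q -> pterm_at0 p = pterm_at0 q.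
Proof.
elim=> //=.
- by move=> q' p' r _ -> _ ->.
- by move=> p1 p2 q1 q2 _ -> _ ->.
- by move=> p1 p2 q1 q2 _ -> _ ->.
- by move=> *; rewrite addrA.
- by move=> *; rewrite addrC.
- by move=> *; rewrite add0r.
- by move=> *; rewrite mulrA.
- by move=> *; rewrite mul1r.
- by move=> *; rewrite mulr1.
- by move=> *; rewrite mul0r.
- by move=> *; rewrite mulrDl.
- by move=> *; rewrite mulrDr.
- by move=> a p'; rewrite mulr_algl mulr_algr.
Qed.

Lemma bone_neq0 : bC 1 != 0 :> bpoly.
Proof.
apply/eqP => /ppiP/pterm_at0_eqv /= /eqP.
by rewrite oner_eq0.
Qed.

HB.instance Definition _ := GRing.Zmodule_isNzRing.Build bpoly
  bmulA bmul1 bmulr1 bmulDl bmulDr bone_neq0.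

Lemma bC_is_zmod_morphism : zmod_morphism bC.
Proof.
have bCD : {morph bC : x y / x + y}.
  by move=> x y; rewrite -[RHS]/(badd _ _) baddE; apply/ppiP/peqv_constD.
by move=> x y; apply/(addIr (bC y)); rewrite -bCD !subrK.
Qed.

Lemma bC_is_monoid_morphism : monoid_morphism bC.
Proof.
split=> // x y; rewrite -[RHS]/(bmul _ _) bmulE.
by apply/ppiP/peqv_constM.
Qed.

HB.instance Definition _ := GRing.isZmodMorphism.Build B bpoly bC
  bC_is_zmod_morphism.
HB.instance Definition _ := GRing.isMonoidMorphism.Build B bpoly bC
  bC_is_monoid_morphism.

Definition bscale (a : K) (x : bpoly) : bpoly := bC a%:A * x.

Lemma bscaleC a x : bC a%:A * x = x * bC a%:A.
Proof.
have [p ->] := ppiE x.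
by rewrite -[LHS]/(bmul _ _) -[RHS]/(bmul _ _) !bmulE; apply/ppiP/peqv_scaleC.
Qed.

Lemma bscaleA a b x : bscale a (bscale b x) = bscale (a * b) x.
Proof. by rewrite /bscale mulrA -rmorphM /= -scalerAl mul1r scalerA. Qed.

Lemma bscale1 : left_id 1 bscale.
Proof. by move=> x; rewrite /bscale scale1r rmorph1 mul1r. Qed.

Lemma bscaleDr : right_distributive bscale +%R.
Proof. by move=> a x y; rewrite /bscale mulrDr. Qed.

Lemma bscaleDl x : {morph bscale^~ x : a b / a + b}.
Proof. by move=> a b; rewrite /bscale scalerDl rmorphD mulrDl. Qed.

HB.instance Definition _ := GRing.Zmodule_isLmodule.Build K bpoly
  bscaleA bscale1 bscaleDr bscaleDl.

Lemma bscaleAl (a : K) (x y : bpoly) : a *: (x * y) = a *: x * y.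
Proof. exact: mulrA. Qed.

HB.instance Definition _ := GRing.Lmodule_isLalgebra.Build K bpoly bscaleAl.

Lemma bscaleAr (a : K) (x y : bpoly) : a *: (x * y) = x * (a *: y).
Proof.
by rewrite -[LHS]/(bC _ * _) -[a *: y]/(bC _ * _) mulrA bscaleC -mulrA.
Qed.

HB.instance Definition _ := GRing.Lalgebra_isAlgebra.Build K bpoly bscaleAr.

Lemma bC_is_scalable : scalable bC.
Proof. by move=> a x; rewrite -[RHS]/(bC _ * _) -rmorphM /= mulr_algl. Qed.

HB.instance Definition _ := GRing.isScalable.Build K B bpoly *:%R bC
  bC_is_scalable.

Fixpoint pstar (p : pterm) : pterm :=
  match p with
  | PConst b => PConst (star b)
  | PVar => PVar
  | PAdd p q => PAdd (pstar p) (pstar q)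
  | PMul p q => PMul (pstar q) (pstar p)
  end.

Lemma pstar_eqv p q : peqv p q -> peqv (pstar p) (pstar q).
Proof.
elim=> /=.
- by move=> *; exact: peqv_refl.
- by move=> *; exact: peqv_sym.
- by move=> q' p' r _ h1 _ h2; exact: peqv_trans h2.
- by move=> *; exact: peqv_add.
- by move=> *; exact: peqv_mul.
- by move=> *; exact: peqv_addA.
- by move=> *; exact: peqv_addC.
- by move=> *; rewrite star0; exact: peqv_add0.
- by move=> *; exact/peqv_sym/peqv_mulA.
- by move=> *; rewrite star1; exact: peqv_mulr1.
- by move=> *; rewrite star1; exact: peqv_mul1.
- move=> p'; rewrite star0 -(scale0r (1 : B)).
  apply: (peqv_trans (peqv_sym (peqv_scaleC 0 _))).
  by rewrite scale0r; exact: peqv_mul0.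
- by move=> *; exact: peqv_mulDr.
- by move=> *; exact: peqv_mulDl.
- by move=> *; rewrite starD; exact: peqv_constD.
- by move=> *; rewrite starM; exact: peqv_constM.
- by move=> a p'; rewrite starZ star1; exact/peqv_sym/peqv_scaleC.
Qed.

Definition bstar (x : bpoly) : bpoly := ppi (pstar (repr x)).

Lemma bstarE p : bstar (ppi p) = ppi (pstar p).
Proof. by apply/ppiP/pstar_eqv/ppi_repr. Qed.

Lemma bstarK : involutive bstar.
Proof.
move=> x; have [p ->] := ppiE x; rewrite !bstarE; congr ppi.
by elim: p => //= [b|p -> q ->|p -> q ->] //; rewrite starK.
Qed.

Lemma bstarD : {morph bstar : x y / x + y}.
Proof.
move=> x y; have [[p ->] [q ->]] := conj (ppiE x) (ppiE y).
by rewrite -[ppi p + _]/(badd _ _) -[RHS]/(badd _ _) baddE !bstarE baddE.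
Qed.

Lemma bstarM (x y : bpoly) : bstar (x * y) = bstar y * bstar x.
Proof.
have [[p ->] [q ->]] := conj (ppiE x) (ppiE y).
by rewrite -[ppi p * _]/(bmul _ _) -[RHS]/(bmul _ _) bmulE !bstarE bmulE.
Qed.

Lemma bstarC b : bstar (bC b) = bC (star b).
Proof. exact: bstarE. Qed.

Lemma bstarX : bstar bX = bX.
Proof. exact: bstarE. Qed.

Lemma bstarZ (a : K) (x : bpoly) : bstar (a *: x) = Num.conj a *: bstar x.
Proof.
rewrite -[a *: x]/(bC _ * _) bstarM bstarC starZ star1 -bscaleC.
by [].
Qed.

HB.instance Definition _ := isStarAlgebra.Build K bpoly
  bstarK bstarD bstarM bstarZ.

Lemma bpoly_ind (P : bpoly -> Prop) :
  (forall b, P (bC b)) -> P bX ->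
  (forall x y, P x -> P y -> P (x + y)) ->
  (forall x y, P x -> P y -> P (x * y)) -> forall x, P x.
Proof.
move=> PC PX PD PM x; have [p ->] := ppiE x.
elim: p => // [p hp q hq|p hp q hq].
  by rewrite -baddE; exact: PD.
by rewrite -bmulE; exact: PM.
Qed.

(* b_0 X b_1 ... X b_n, with bs = [b_1; ...; b_n] *)
Definition bmono (b0 : B) (bs : seq B) : bpoly :=
  bC b0 * \prod_(b <- bs) (bX * bC b).

Lemma bmono_nil b0 : bmono b0 [::] = bC b0.
Proof. by rewrite /bmono big_nil mulr1. Qed.

Lemma bmono_cons b0 b bs : bmono b0 (b :: bs) = bC b0 * bX * bmono b bs.
Proof. by rewrite /bmono big_cons !mulrA. Qed.

Lemma bmonoMl c b0 bs : bC c * bmono b0 bs = bmono (c * b0) bs.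
Proof. by rewrite /bmono mulrA -rmorphM. Qed.

Lemma bmonoM b0 bs b c0 cs :
  bmono b0 (rcons bs b) * bmono c0 cs = bmono b0 (bs ++ b * c0 :: cs).
Proof.
elim: bs b0 => [|b1 bs IH] b0 /=.
  by rewrite !bmono_cons bmono_nil -[in LHS]mulrA bmonoMl.
by rewrite !bmono_cons -mulrA IH.
Qed.

Lemma bpoly_span (x : bpoly) :
  exists ws : seq (B * seq B), x = \sum_(w <- ws) bmono w.1 w.2.
Proof.
elim/bpoly_ind: x => [b||x y [ws ->] [vs ->]|x y [ws ->] [vs ->]].
- by exists [:: (b, [::])]; rewrite big_seq1 bmono_nil.
- exists [:: (1, [:: 1])]; rewrite big_seq1 bmono_cons bmono_nil.
  by rewrite rmorph1 mul1r mulr1.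
- by exists (ws ++ vs); rewrite big_cat.
- have monoM (w v : B * seq B) : exists u : B * seq B,
      bmono w.1 w.2 * bmono v.1 v.2 = bmono u.1 u.2.
    case: w v => b0 bs [c0 cs] /=; case/lastP: bs => [|bs b].
      by exists (b0 * c0, cs); rewrite bmono_nil bmonoMl.
    by exists (b0, bs ++ b * c0 :: cs); rewrite bmonoM.
  pose m w v := sval (cid (monoM w v)).
  exists [seq m w v | w <- ws, v <- vs].
  rewrite big_allpairs_dep mulr_suml; apply: eq_bigr => w _.
  rewrite mulr_sumr; apply: eq_bigr => v _.
  by rewrite /m; case: cid.
Qed.

End Polynomials.

Arguments PVar {K B}.

Section Evaluation.
Variables (K : numClosedFieldType) (B A : starAlgType K).
Variables (iota : {lrmorphism B -> A}) (Z : A).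

Fixpoint peval (p : pterm B) : A :=
  match p with
  | PConst b => iota b
  | PVar => Z
  | PAdd p q => peval p + peval q
  | PMul p q => peval p * peval q
  end.

Lemma peval_eqv p q : peqv p q -> peval p = peval q.
Proof.
elim=> //=.
- by move=> q' p' r _ -> _ ->.
- by move=> p1 p2 q1 q2 _ -> _ ->.
- by move=> p1 p2 q1 q2 _ -> _ ->.
- by move=> *; rewrite addrA.
- by move=> *; rewrite addrC.
- by move=> *; rewrite rmorph0 add0r.
- by move=> *; rewrite mulrA.
- by move=> *; rewrite rmorph1 mul1r.
- by move=> *; rewrite rmorph1 mulr1.
- by move=> *; rewrite rmorph0 mul0r.
- by move=> *; rewrite mulrDl.
- by move=> *; rewrite mulrDr.
- by move=> *; rewrite rmorphD.
- by move=> *; rewrite rmorphM.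
- by move=> a p'; rewrite linearZ /= rmorph1 mulr_algl mulr_algr.
Qed.

Definition beval (x : bpoly B) : A := peval (repr x).

Lemma bevalE p : beval (ppi p) = peval p.
Proof. exact/peval_eqv/ppi_repr. Qed.

Lemma bevalC b : beval (bC b) = iota b. Proof. exact: bevalE. Qed.

Lemma bevalX : beval (bX B) = Z. Proof. exact: bevalE. Qed.

Lemma beval_is_zmod_morphism : zmod_morphism beval.
Proof.
have bD : {morph beval : x y / x + y}.
  move=> x y; have [[p ->] [q ->]] := conj (ppiE x) (ppiE y).
  by rewrite -[ppi p + _]/(badd _ _) baddE !bevalE.
by move=> x y; apply/(addIr (beval y)); rewrite -bD !subrK.
Qed.

Lemma beval_is_monoid_morphism : monoid_morphism beval.
Proof.
split=> [|x y]; first by rewrite -[1]/(bC 1) bevalC rmorph1.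
have [[p ->] [q ->]] := conj (ppiE x) (ppiE y).
by rewrite -[ppi p * _]/(bmul _ _) bmulE !bevalE.
Qed.

HB.instance Definition _ := GRing.isZmodMorphism.Build (bpoly B) A beval
  beval_is_zmod_morphism.
HB.instance Definition _ := GRing.isMonoidMorphism.Build (bpoly B) A beval
  beval_is_monoid_morphism.

Lemma beval_is_scalable : scalable beval.
Proof.
move=> a x; rewrite -[a *: x]/(bC _ * _) rmorphM /= bevalC linearZ /= rmorph1.
by rewrite mulr_algl.
Qed.

HB.instance Definition _ := GRing.isScalable.Build K (bpoly B) A *:%R beval
  beval_is_scalable.

Lemma beval_mono b0 bs :
  beval (bmono b0 bs) = iota b0 * \prod_(b <- bs) (Z * iota b).
Proof.
rewrite /bmono rmorphM /= bevalC rmorph_prod; congr (_ * _).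
by apply: eq_bigr => b _; rewrite rmorphM /= bevalC bevalX.
Qed.

End Evaluation.

Section Freeness.
Variables (K : numClosedFieldType) (B : starAlgType K) (V : lmodType K).

Definition multilinear (f : seq B -> V) :=
  forall (s t : seq B) (a : K) (x y : B),
    f (s ++ (a *: x + y) :: t) = a *: f (s ++ x :: t) + f (s ++ y :: t).

Fixpoint pact (p : pterm B) (f : B -> seq B -> V) : B -> seq B -> V :=
  match p with
  | PConst b => fun c w => f (b * c) w
  | PVar => fun c w => f 1 (c :: w)
  | PAdd p q => fun c w => pact p f c w + pact q f c w
  | PMul p q => pact q (pact p f)
  end.

Definition mlin2 (f : B -> seq B -> V) :=
  (forall w (a : K) x y, f (a *: x + y) w = a *: f x w + f y w)
  /\ (forall c, multilinear (f c)).

Lemma pact_mlin p f : mlin2 f -> mlin2 (pact p f).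
Proof.
elim: p f => [b|/=|p hp q hq|p hp q hq] f hf /=.
- case: hf => h1 h2; split=> [w a x y|c]; last exact: h2.
  by rewrite mulrDr -scalerAr h1.
- case: hf => h1 h2; split=> [w a x y|c s t a x y]; first exact: (h2 1 [::]).
  exact: (h2 1 (c :: s)).
- have [[h1 h2] [h3 h4]] := (hp f hf, hq f hf); split=> [w a x y|c s t a x y].
    by rewrite h1 h3 scalerDr addrACA.
  by rewrite h2 h4 scalerDr addrACA.
- exact/hq/hp.
Qed.

Lemma pact_eqv p q : peqv p q -> forall f, mlin2 f -> pact p f = pact q f.
Proof.
have fD f (x y : B) w : mlin2 f -> f (x + y) w = f x w + f y w.
  by case=> h _; have := h w 1 x y; rewrite !scale1r.
have f0 f w : mlin2 f -> f 0 w = 0.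
  by move=> hf; apply: (addrI (f 0 w)); rewrite -fD // !addr0.
have fZ f a (x : B) w : mlin2 f -> f (a *: x) w = a *: f x w.
  by move=> hf; have := hf.1 w a x 0; rewrite !addr0 f0 // addr0.
have pD r g h f : (forall c w, f c w = g c w + h c w) ->
    forall c w, pact r f c w = pact r g c w + pact r h c w.
  elim: r f g h => [b|/=|r1 h1 r2 h2|r1 h1 r2 h2] f g h e c w //=.
    by rewrite (h1 f g h) // (h2 f g h) // addrACA.
  by apply: h2 => c' w'; exact: h1.
have pZ r (a : K) g f : (forall c w, f c w = a *: g c w) ->
    forall c w, pact r f c w = a *: pact r g c w.
  elim: r f g => [b|/=|r1 h1 r2 h2|r1 h1 r2 h2] f g e c w //=.
    by rewrite (h1 f g) // (h2 f g) // scalerDr.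
  by apply: h2 => c' w'; exact: h1.
have ext g h : (forall c w, g c w = h c w) -> g = h :> (B -> seq B -> V).
  by move=> e; apply/funext => c; apply/funext.
elim=> //=.
- by move=> p' q' _ h f hf; rewrite h.
- by move=> q' p' r _ h1 _ h2 f hf; rewrite h1 // h2.
- by move=> p1 p2 q1 q2 _ h1 _ h2 f hf; rewrite h1 // h2.
- by move=> p1 p2 q1 q2 _ h1 _ h2 f hf; rewrite h1 // h2 //; exact: pact_mlin.
- by move=> *; apply: ext => c w; rewrite addrA.
- by move=> *; apply: ext => c w; rewrite addrC.
- by move=> p' f hf; apply: ext => c w; rewrite mul0r f0 // add0r.
- by move=> p' f hf; congr pact; apply: ext => c w; rewrite mul1r.
- by move=> p' f hf; apply: ext => c w; rewrite mul1r.
- move=> p' f hf; apply: ext => c w.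
  rewrite (pZ p' 0 f) => [|c' w']; first by rewrite scale0r mul0r f0.
  by rewrite mul0r f0 // scale0r.
- by move=> p1 q1 r f hf; apply: ext; exact: pD.
- by move=> *; apply: ext => c w; rewrite mulrDl fD.
- by move=> b c f hf; apply: ext => d w; rewrite mulrA.
- move=> a p' f hf; apply: ext => c w.
  have hp := pact_mlin p' hf.
  rewrite (pZ p' a f) => [|c' w']; last by rewrite mulr_algl fZ.
  by rewrite mulr_algl fZ.
Qed.

Lemma mlin2_behead f : multilinear f -> mlin2 (fun b bs => f (b :: bs)).
Proof. by move=> hf; split=> [w a x y|c s t a x y]; [exact: (hf [::])|exact: (hf (c :: s))]. Qed.

(* Together with [bpoly_span], this is the isomorphism of the span of the
   b_0 X b_1 ... X b_n with the (n+1)-fold tensor power of B, and the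
   independence of these spans. *)
Lemma bpoly_universal (f : seq B -> V) : multilinear f ->
  exists phi : {linear bpoly B -> V},
    (forall b bs, phi (bmono b bs) = f (b :: bs)) /\
    forall psi : {linear bpoly B -> V},
      (forall b bs, psi (bmono b bs) = f (b :: bs)) -> psi =1 phi.
Proof.
move=> hf; have hf2 := mlin2_behead hf.
pose phi (x : bpoly B) : V := pact (repr x) (fun b bs => f (b :: bs)) 1 [::].
have phiE p : phi (ppi p) = pact p (fun b bs => f (b :: bs)) 1 [::].
  by rewrite /phi (pact_eqv (ppi_repr p)).
have phi_lin : linear phi.
  move=> a x y; have [[p ->] [q ->]] := conj (ppiE x) (ppiE y).
  rewrite -[a *: _]/(bmul _ _) bmulE -[ppi _ + _]/(badd _ _) baddE !phiE /=.
  congr (_ + _).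
  have /(congr1 (fun g => g 1 [::])) /= -> := pact_eqv (peqv_scaleC a p) hf2.
  rewrite mulr1; have h := (pact_mlin p hf2).1 [::].
  have h0 := h 1 0 0; rewrite scale1r addr0 scale1r in h0.
  have {}h0 := addrI _ (etrans (addr0 _) h0).
  by have := h a 1 0; rewrite -h0 !addr0.
have phiM b bs : phi (bmono b bs) = f (b :: bs).
  have h g : mlin2 g -> exists p, bmono b bs = ppi p /\ pact p g 1 [::] = g b bs.
    elim: bs b g => [|c bs IH] b g hg.
      by exists (PConst b); rewrite bmono_nil /= mulr1.
    have [|p [e1 e2]] := IH c (pact PVar (pact (PConst b) g)).
      exact/pact_mlin/pact_mlin.
    exists (PMul (PMul (PConst b) PVar) p); split=> /=.
      by rewrite bmono_cons e1 -!bmulE.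
    by rewrite e2 /= mulr1.
  by have [p [-> <-]] := h _ hf2; rewrite phiE.
pose linm := GRing.isLinear.Build K (bpoly B) V *:%R phi phi_lin.
pose phiL : {linear bpoly B -> V} := HB.pack phi linm.
exists phiL; split=> [//|psi hpsi] x; have [ws ->] := bpoly_span x.
by rewrite !linear_sum; apply: eq_bigr => w _; rewrite hpsi -phiM.
Qed.

End Freeness.

Section Series.
Variables (K : numClosedFieldType) (B : starAlgType K).

Record Sigma_alg := SigmaAlg {
  sigma_fun :> {linear bpoly B -> B};
  sigma_bimod : forall b b' p, sigma_fun (bC b * p * bC b') = b * sigma_fun p * b';
  sigma_C : forall b, sigma_fun (bC b) = b
}.

Definition sigma_positive (mu : Sigma_alg) :=
  forall p : bpoly B, nonneg (mu (star p * p)).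

(* The n-th component of F is its restriction to lists of length n - 1. *)
Record Ser := MkSer {
  ser_fun :> seq B -> B;
  ser_multilinear : multilinear ser_fun
}.

Lemma Ser_ext (F G : Ser) : F =1 G -> F = G.
Proof.
case: F G => [f hf] [g hg] /= /funext e; case: _ / e in hg *.
by congr MkSer; exact: Prop_irrelevance.
Qed.

Lemma Sigma_alg_ext (mu nu : Sigma_alg) : mu =1 nu -> mu = nu.
Proof.
case: mu nu => [f f1 f2] [g g1 g2] /= e.
have {}e : f = g.
  case: f g {f1 f2 g1 g2} e => [f cf] [g cg] /= /funext e.
  case: _ / e in cg *; congr GRing.Linear.Pack.
  case: cf cg => [[a] [b] ] [[a'] [b'] ].
  have -> : a = a' by exact: Prop_irrelevance.
  by have -> : b = b' by exact: Prop_irrelevance.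
case: _ / e in g1 g2 *.
by congr SigmaAlg; exact: Prop_irrelevance.
Qed.

(* X b_1 X ... b_{n-1} X *)
Definition xword (bs : seq B) : bpoly B := bX B * \prod_(b <- bs) (bC b * bX B).

Lemma moment_multilinear (mu : Sigma_alg) : multilinear (fun bs => mu (xword bs)).
Proof.
move=> s t a x y; rewrite -linearP; congr (mu _).
rewrite /xword !big_cat !big_cons /= linearP /= mulrDl -scalerAl.
rewrite [in LHS]mulrDl [in LHS]mulrDr [in LHS]mulrDr.
by rewrite -!(scalerAl, scalerAr).
Qed.

Definition moment_series (mu : Sigma_alg) : Ser := MkSer (moment_multilinear mu).

Lemma comp_multilinear (alpha : {linear B -> B}) (F : Ser) :
  multilinear (fun bs => alpha (F bs)).
Proof. by move=> s t a x y; rewrite ser_multilinear linearP. Qed.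

Definition ser_comp (alpha : {linear B -> B}) (F : Ser) : Ser :=
  MkSer (comp_multilinear alpha F).

(* For bs = [b_1; ...; b_(n-1)], the list [b_(i+1); ...; b_(j-1)]. *)
Definition block (bs : seq B) (i j : nat) : seq B := take (j - i).-1 (drop i bs).

(* The sum over 1 <= k <= n and 0 = q_0 < q_1 < ... < q_k = n of
   F(b_(q_0+1), ..., b_(q_1-1)) b_(q_1) F(b_(q_1+1), ..., b_(q_2-1)) b_(q_2) ... ;
   here n = size bs + 1 and b_l is at index l - 1 of bs. *)
Definition bool_sum (F : seq B -> B) (bs : seq B) : B :=
  let n := (size bs).+1 in
  \sum_(1 <= k < n.+1)
   \sum_(t : k.+1.-tuple 'I_n.+1 |
      [&& nth 0 (map val t) 0 == 0, nth 0 (map val t) k == n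
        & sorted ltn (map val t)]%N)
     let q := nth 0%N (map val t) in
     F (block bs (q 0) (q 1)) *
     \prod_(1 <= j < k) (bs`_(q j).-1 * F (block bs (q j) (q j.+1))).

Section BoolSumRec.
Variable F : seq B -> B.

Fixpoint brec (m : nat) (bs : seq B) : B :=
  if m is m'.+1 then
    F bs + \sum_(0 <= i < size bs) F (take i bs) * bs`_i * brec m' (drop i.+1 bs)
  else 0.

Section Fixed.
Variable bs : seq B.
Let n := (size bs).+1.

Fixpoint chw (p : nat) (rs : seq nat) : B :=
  if rs is q :: rs' then bs`_p.-1 * F (block bs p q) * chw q rs' else 1.

Lemma prod_chw p rs :
  \prod_(0 <= j < size rs)
     (bs`_(nth 0%N (p :: rs) j).-1 *
      F (block bs (nth 0%N (p :: rs) j) (nth 0%N (p :: rs) j.+1))) = chw p rs.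
Proof.
elim: rs p => [|q rs IH] p /=; first by rewrite big_nil.
by rewrite big_nat_recl //= -IH.
Qed.

Lemma sum_tuple0 (I : finType) (G : seq I -> B) :
  \sum_(t : 0.-tuple I) G t = G [::].
Proof.
by rewrite (big_pred1 [tuple]) // => t; apply/esym/eqP; exact: tuple0.
Qed.

Lemma sum_tupleS (I : finType) k (G : seq I -> B) :
  \sum_(t : k.+1.-tuple I) G t = \sum_(x : I) \sum_(t : k.-tuple I) G (x :: t).
Proof.
rewrite pair_bigA /=.
rewrite (reindex (fun p : I * k.-tuple I => [tuple of p.1 :: p.2])) //=.
exists (fun t => (thead t, [tuple of behead t])) => [[x t] _|t _] /=.
  by congr (_, _); apply/val_inj.
by rewrite [RHS]tuple_eta; apply/val_inj.
Qed.

Let G (p : nat) (r : seq 'I_n.+1) : B :=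
  if path ltn p (map val r) && (last p (map val r) == n)
  then chw p (map val r) else 0.

Let T k p := \sum_(r : k.-tuple 'I_n.+1) G p r.
Let U N p := \sum_(0 <= k < N) T k p.
Let V N p := \sum_(p.+1 <= x < n.+1) F (block bs p x) * U N x.

Lemma ord_sum_gt p (f : nat -> B) :
  \sum_(x < n.+1) (if (p < x)%N then f x else 0) = \sum_(p.+1 <= x < n.+1) f x.
Proof.
rewrite (big_nat_widenl _ 0) // big_mkord -big_mkcond /=.
by apply: eq_bigl.
Qed.

Lemma TS k p :
  T k.+1 p = bs`_p.-1 * \sum_(p.+1 <= x < n.+1) F (block bs p x) * T k x.
Proof.
rewrite /T sum_tupleS mulr_sumr -ord_sum_gt; apply: eq_bigr => x _.
case: ifPn => px; last first.
  by rewrite big1 // => t _; rewrite /G /= (negbTE px).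
rewrite mulrA mulr_sumr; apply: eq_bigr => t _.
by rewrite /G /= px /=; case: ifP => _ //; rewrite mulr0.
Qed.

Lemma US N p : U N.+1 p = (p == n)%:R + bs`_p.-1 * V N p.
Proof.
rewrite /U big_nat_recl //; congr (_ + _).
  by rewrite /T sum_tuple0 /G /=; case: eqP.
rewrite /V; under [in LHS]eq_bigr do rewrite TS.
rewrite -mulr_sumr exchange_big /=; congr (_ * _); apply: eq_bigr => x _.
by rewrite mulr_sumr.
Qed.

Lemma V_brec N m p : (p < n)%N -> (n - p <= N)%N -> (n - p <= m)%N ->
  V N p = brec m (drop p bs).
Proof.
elim: m N p => [|m IH] N p pn hN hm.
  by move: hm; rewrite leqn0 subn_eq0 leqNgt pn.
case: N hN => [|N] hN; first by move: hN; rewrite leqn0 subn_eq0 leqNgt pn.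
rewrite /V big_nat_recr //= US eqxx.
have Vn : V N n = 0 by rewrite /V big_geq.
rewrite Vn mulr0 addr0 mulr1 addrC; congr (_ + _).
  by rewrite /block take_oversize // size_drop /n subSn.
rewrite size_drop.
have -> : (size bs - p = n - p.+1)%N by rewrite /n subSS.
rewrite -[p.+1]add0n big_addn.
rewrite big_nat_cond [RHS]big_nat_cond; apply: eq_bigr => i.
rewrite andbT => /andP[_ hi].
have hx : (i + p.+1 < n)%N by lia.
rewrite US (ltn_eqF hx) add0r (IH N).
- rewrite /block nth_drop drop_drop mulrA.
  have -> : (i + p.+1 - p).-1 = i by lia.
  have -> : (i + p.+1).-1 = (p + i)%N by lia.
  by have -> : (i.+1 + p)%N = (i + p.+1)%N by lia.
- by [].
- lia.
- lia.
Qed.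

Lemma bool_sum_brec m : (size bs < m)%N -> bool_sum F bs = brec m bs.
Proof.
move=> hm; rewrite -[X in brec _ X]drop0 -(V_brec (N := n)) ?subn0 //.
rewrite /bool_sum -/n big_add1 /= /V /U.
under [RHS]eq_bigr do rewrite mulr_sumr.
rewrite exchange_big /=; apply: eq_bigr => k _.
rewrite big_mkcond /= -ord_sum_gt.
pose H (t : seq 'I_n.+1) : B :=
  if [&& nth 0 (map val t) 0 == 0, nth 0 (map val t) k.+1 == n
        & sorted ltn (map val t)]%N
  then F (block bs (nth 0%N (map val t) 0) (nth 0%N (map val t) 1)) *
     \prod_(1 <= j < k.+1) (bs`_(nth 0%N (map val t) j).-1 *
        F (block bs (nth 0%N (map val t) j) (nth 0%N (map val t) j.+1)))
  else 0.
rewrite -[LHS]/(\sum_(t : k.+2.-tuple 'I_n.+1) H t).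
rewrite sum_tupleS (bigD1 ord0) //= [X in _ + X]big1 ?addr0; last first.
  move=> x x0; rewrite big1 // => t _; rewrite /H /=.
  by case: eqP => // e; case/eqP: x0; apply/val_inj.
rewrite (sum_tupleS k (fun r => H (ord0 :: r))); apply: eq_bigr => x _.
case: ifPn => x0; last first.
  by rewrite big1 // => t _; rewrite /H /= (negbTE x0) andbF.
rewrite /T mulr_sumr; apply: eq_bigr => t _.
rewrite /H /G /= x0 /= andbC.
have -> : nth 0%N (val x :: map val t) k = last (val x) (map val t).
  by have := nth_last 0%N (val x :: map val t); rewrite /= size_map size_tuple.
case: ifP => _; last by rewrite mulr0.
congr (_ * _); rewrite big_add1 /= -prod_chw size_map size_tuple.
by apply: eq_bigr.
Qed.

End Fixed.

Lemma bool_sumE bs : bool_sum F bs =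
  F bs + \sum_(0 <= i < size bs) F (take i bs) * bs`_i * bool_sum F (drop i.+1 bs).
Proof.
rewrite (@bool_sum_brec bs (size bs).+1) //=; congr (_ + _).
rewrite big_nat_cond [RHS]big_nat_cond; apply: eq_bigr => i.
rewrite andbT => /andP[_ hi]; rewrite (@bool_sum_brec _ (size bs)) //.
by rewrite size_drop ltn_subrL /= (leq_trans _ hi).
Qed.

End BoolSumRec.

Definition conv (F G : seq B -> B) (bs : seq B) : B :=
  \sum_(0 <= i < size bs) F (take i bs) * bs`_i * G (drop i.+1 bs).

Lemma conv_cat F G s z t : conv F G (s ++ z :: t) =
  \sum_(0 <= i < size s) F (take i s) * s`_i * G (drop i.+1 s ++ z :: t)
  + F s * z * G t
  + \sum_(0 <= j < size t) F (s ++ z :: take j t) * t`_j * G (drop j.+1 t).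
Proof.
rewrite /conv size_cat /= (@big_cat_nat _ _ _ (size s)) ?leq_addr //= -addrA.
congr (_ + _).
  rewrite big_nat_cond [RHS]big_nat_cond; apply: eq_bigr => i.
  rewrite andbT => /andP[_ hi]; rewrite nth_cat hi takel_cat ?(ltnW hi) //.
  rewrite drop_cat; case: (ltnP i.+1) => // hi'.
  by have -> : i.+1 = size s by [lia]; rewrite subnn drop0 drop_size.
rewrite -{1}[size s]add0n big_addn addKn big_nat_recl //; congr (_ + _).
  by rewrite add0n take_size_cat // nth_cat ltnn subnn -cat_rcons drop_size_cat // size_rcons.
apply: eq_bigr => j _.
have e1 : (j.+1 + size s)%N = (size s + j.+1)%N by lia.
rewrite e1 nth_cat ltnNge leq_addr /= addKn /=.
rewrite take_cat ltnNge leq_addr /= addKn /=.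
by rewrite drop_cat ltnNge -addnS leq_addr /= addKn.
Qed.

Lemma conv_linear F G s t a x y :
  (forall j, (j < size t)%N -> F (s ++ (a *: x + y) :: take j t) =
     a *: F (s ++ x :: take j t) + F (s ++ y :: take j t)) ->
  (forall i, (i < size s)%N -> G (drop i.+1 s ++ (a *: x + y) :: t) =
     a *: G (drop i.+1 s ++ x :: t) + G (drop i.+1 s ++ y :: t)) ->
  conv F G (s ++ (a *: x + y) :: t) =
    a *: conv F G (s ++ x :: t) + conv F G (s ++ y :: t).
Proof.
move=> hF hG; rewrite !conv_cat !scalerDr.
rewrite [RHS]addrACA; congr (_ + _); last first.
  rewrite scaler_sumr -big_split /= big_nat_cond [RHS]big_nat_cond.
  apply: eq_bigr => j; rewrite andbT => /andP[_ hj].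
  by rewrite hF // !mulrDl -!scalerAl.
rewrite [RHS]addrACA; congr (_ + _).
  rewrite scaler_sumr -big_split /= big_nat_cond [RHS]big_nat_cond.
  apply: eq_bigr => i; rewrite andbT => /andP[_ hi].
  by rewrite hG // !mulrDr -!scalerAr.
by rewrite mulrDr mulrDl -!(scalerAr, scalerAl).
Qed.

Lemma bool_sum_multilinear (F : Ser) : multilinear (bool_sum F).
Proof.
move=> s; have [k] := ubnP (size s); elim: k s => // k IH s hs t a x y.
rewrite !(bool_sumE F (_ ++ _)) -!/(conv _ _ _) ser_multilinear conv_linear.
- by rewrite scalerDr addrACA.
- by move=> j _; rewrite ser_multilinear.
- move=> i hi; apply: IH; rewrite size_drop (leq_trans _ (hs : (size s <= k)%N)) //.
  by rewrite ltn_subrL (leq_trans _ hi).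
Qed.

(* Inverse of [bool_sum], by recursion on the length of the argument. *)
Fixpoint btr (M : seq B -> B) (m : nat) (bs : seq B) : B :=
  if m is m'.+1 then
    M bs - \sum_(0 <= i < size bs) btr M m' (take i bs) * bs`_i * M (drop i.+1 bs)
  else 0.

Lemma btr_stable M m m' bs : (size bs < m)%N -> (size bs < m')%N ->
  btr M m bs = btr M m' bs.
Proof.
elim: m m' bs => // m IH [//|m'] bs h h' /=; congr (_ - _).
rewrite big_nat_cond [RHS]big_nat_cond; apply: eq_bigr => i.
by rewrite andbT => /andP[_ hi]; rewrite (IH m') // size_take hi; lia.
Qed.

Definition bool_inv M bs := btr M (size bs).+1 bs.

Lemma bool_invE M bs : bool_inv M bs = M bs - conv (bool_inv M) M bs.
Proof.
rewrite {1}/bool_inv /=; congr (_ - _).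
rewrite /conv big_nat_cond [RHS]big_nat_cond; apply: eq_bigr => i.
rewrite andbT => /andP[_ hi]; congr (_ * _ * _).
by apply: btr_stable; rewrite size_take hi // ltnS.
Qed.

Lemma bool_invK M : bool_sum (bool_inv M) =1 M.
Proof.
move=> bs; have [k] := ubnP (size bs); elim: k bs => // k IH bs hs.
rewrite bool_sumE bool_invE -[RHS](subrK (conv (bool_inv M) M bs)).
congr (_ + _); rewrite /conv big_nat_cond [RHS]big_nat_cond.
apply: eq_bigr => i; rewrite andbT => /andP[_ hi]; rewrite IH // size_drop; lia.
Qed.

Lemma bool_sum_inj (F G : seq B -> B) : bool_sum F =1 bool_sum G -> F =1 G.
Proof.
move=> FG bs; have [k] := ubnP (size bs); elim: k bs => // k IH bs hs.
have := FG bs; rewrite !bool_sumE.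
suff -> : \sum_(0 <= i < size bs) F (take i bs) * bs`_i * bool_sum F (drop i.+1 bs)
        = \sum_(0 <= i < size bs) G (take i bs) * bs`_i * bool_sum G (drop i.+1 bs).
  exact: addIr.
rewrite big_nat_cond [RHS]big_nat_cond; apply: eq_bigr => i.
rewrite andbT => /andP[_ hi]; rewrite IH ?FG // size_take hi; lia.
Qed.

Lemma bool_inv_multilinear (M : Ser) : multilinear (bool_inv M).
Proof.
move=> s t; have [k] := ubnP (size t); elim: k t => // k IH t ht a x y.
rewrite !(bool_invE M (_ ++ _)) ser_multilinear conv_linear.
- by rewrite scalerBr opprD addrACA.
- by move=> j hj; apply: IH; rewrite size_take hj (leq_trans hj).
- by move=> i _; rewrite ser_multilinear.
Qed.

Lemma B_transform_exists (mu : Sigma_alg) :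
  exists F : Ser, forall bs, moment_series mu bs = bool_sum F bs.
Proof.
exists (MkSer (bool_inv_multilinear (moment_series mu))) => bs.
by rewrite bool_invK.
Qed.

Definition B_transform (mu : Sigma_alg) : Ser := sval (cid (B_transform_exists mu)).

Lemma B_transformP mu bs : moment_series mu bs = bool_sum (B_transform mu) bs.
Proof. by rewrite /B_transform; case: cid. Qed.

Lemma B_transform_unique mu (F : Ser) :
  (forall bs, moment_series mu bs = bool_sum F bs) -> F = B_transform mu.
Proof.
by move=> h; apply/Ser_ext/bool_sum_inj => bs; rewrite -h B_transformP.
Qed.

Lemma bmono_rcons b0 bs b : bmono b0 (rcons bs b) = bC b0 * xword bs * bC b.
Proof.
elim: bs b0 => [|c bs IH] b0 /=.
  by rewrite bmono_cons bmono_nil /xword big_nil mulr1.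
by rewrite bmono_cons IH /xword big_cons !mulrA.
Qed.

Lemma moment_series_inj : injective moment_series.
Proof.
move=> mu nu e; apply: Sigma_alg_ext => x; have [ws ->] := bpoly_span x.
rewrite !linear_sum; apply: eq_bigr => -[b0 bs] _ /=.
case/lastP: bs => [|bs b]; first by rewrite bmono_nil !sigma_C.
rewrite bmono_rcons !sigma_bimod; congr (_ * _ * _).
by rewrite -[LHS]/(moment_series mu bs) e.
Qed.

Lemma moment_series_surj (F : Ser) : exists mu, moment_series mu = F.
Proof.
pose g (w : seq B) : B := match w with
  | [::] => 0 | [:: b] => b
  | b0 :: b1 :: bs => b0 * F (belast b1 bs) * last b1 bs end.
have gr b0 bs b : g (b0 :: rcons bs b) = b0 * F bs * b.
  by case: bs => //= c bs; rewrite belast_rcons last_rcons.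
have g_lin : multilinear g.
  move=> [|b0 s] t a x y.
    case/lastP: t => [//|t c]; rewrite !cat0s !gr.
    by rewrite !mulrDl -!scalerAl.
  case/lastP: t => [|t c]; rewrite !cat_cons.
    by rewrite !cats1 !gr mulrDr -scalerAr.
  rewrite -!rcons_cons -!rcons_cat !gr ser_multilinear.
  by rewrite mulrDr mulrDl -scalerAr -scalerAl.
have [phi [phiE _]] := bpoly_universal g_lin.
have phiC b : phi (bC b) = b by rewrite -bmono_nil phiE.
have phi_bimod b b' p : phi (bC b * p * bC b') = b * phi p * b'.
  have [ws ->] := bpoly_span p.
  rewrite mulr_sumr mulr_suml !linear_sum mulr_sumr mulr_suml.
  apply: eq_bigr => -[b0 bs] _ /=; case/lastP: bs => [|bs c].
    by rewrite bmono_nil -!rmorphM /= !phiC.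
  have bCM x y : bC x * bC y = bC (x * y) by rewrite rmorphM.
  have -> : bC b * bmono b0 (rcons bs c) * bC b' = bmono (b * b0) (rcons bs (c * b')).
    by rewrite !bmono_rcons -!bCM !mulrA.
  by rewrite !phiE !gr !mulrA.
exists (SigmaAlg phi_bimod phiC); apply: Ser_ext => bs /=.
have := phiE 1 (rcons bs 1); rewrite bmono_rcons gr rmorph1 !mul1r !mulr1.
by [].
Qed.

Lemma B_transform_bij : bijective B_transform.
Proof.
have surj (F : Ser) : exists mu, B_transform mu = F.
  have [mu e] := moment_series_surj (MkSer (bool_sum_multilinear F)).
  by exists mu; apply/esym/B_transform_unique => bs; rewrite e.
exists (fun F => sval (cid (surj F))) => [mu|F]; last by case: cid.
case: cid => nu /= e; apply/moment_series_inj/Ser_ext => bs.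
by rewrite !B_transformP e.
Qed.

Lemma boolean_power_exists (mu : Sigma_alg) (alpha : {linear B -> B}) :
  exists nu, B_transform nu = ser_comp alpha (B_transform mu).
Proof.
by case: B_transform_bij => g _ gK; exists (g (ser_comp alpha (B_transform mu))).
Qed.

Definition boolean_power (mu : Sigma_alg) (alpha : {linear B -> B}) : Sigma_alg :=
  sval (cid (boolean_power_exists mu alpha)).

Lemma boolean_powerP mu alpha :
  B_transform (boolean_power mu alpha) = ser_comp alpha (B_transform mu).
Proof. by rewrite /boolean_power; case: cid. Qed.

Definition boolean_compound_poisson (mu : Sigma_alg) :=
  exists (nu : Sigma_alg) (kappa : {linear B -> B}),
    [/\ sigma_positive nu, completely_positive kappa
      & B_transform mu = ser_comp kappa (moment_series nu)].

End Series.

Section NCPS.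
Variables (K : numClosedFieldType) (B : starAlgType K).

(* The algebra M = B (+) M_0, as an internal direct sum: B sits in M through
   [ncincl], and M_0 is the subset [nc0] of M. The product formula
   (b1 + m1) (b2 + m2) = b1 b2 + (b1 m2 + m1 b2 + m1 m2) is distributivity. *)
Record ncps := NCPS {
  ncalg :> starAlgType K;
  ncincl : {lrmorphism B -> ncalg};
  ncincl_star : forall b, ncincl (star b) = star (ncincl b);
  nc0 : set ncalg;
  nc0_0 : nc0 0;
  nc0_linear : forall (a : K) m m', nc0 m -> nc0 m' -> nc0 (a *: m + m');
  nc0_mul : forall m m', nc0 m -> nc0 m' -> nc0 (m * m');
  nc0_bimod : forall b b' m, nc0 m -> nc0 (ncincl b * m * ncincl b');
  nc0_star : forall m, nc0 m -> nc0 (star m);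
  nc_sum : forall m, exists b m0, nc0 m0 /\ m = ncincl b + m0;
  nc_direct : forall b, nc0 (ncincl b) -> b = 0;
  ncE : {linear ncalg -> B};
  ncE_unit : ncE 1 = 1;
  ncE_positive : forall m, nonneg (ncE (star m * m));
  ncE_bimod : forall b b' m, ncE (ncincl b * m * ncincl b') = b * ncE m * b'
}.

Arguments ncE {n}.

Variable N : ncps.

Lemma ncEC b : ncE (ncincl N b) = b.
Proof.
by have := ncE_bimod b 1 (1 : N); rewrite ncE_unit rmorph1 !mulr1.
Qed.

Section Distribution.
Variable Z : N.

Let distr_fun (p : bpoly B) : B := ncE (beval (ncincl N) Z p).

Lemma distr_linear : linear distr_fun.
Proof. by move=> a p q; rewrite /distr_fun !linearP. Qed.

Definition distr_lin : {linear bpoly B -> B} :=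
  HB.pack distr_fun (GRing.isLinear.Build K (bpoly B) B *:%R distr_fun distr_linear).

Lemma distr_bimod b b' p : distr_lin (bC b * p * bC b') = b * distr_lin p * b'.
Proof. by rewrite /= /distr_fun !rmorphM /= !bevalC ncE_bimod. Qed.

Lemma distr_C b : distr_lin (bC b) = b.
Proof. by rewrite /= /distr_fun bevalC ncEC. Qed.

Definition distr : Sigma_alg B := SigmaAlg distr_bimod distr_C.

Lemma distrE b0 bs :
  distr (bmono b0 bs) = ncE (ncincl N b0 * \prod_(b <- bs) (Z * ncincl N b)).
Proof. by rewrite /= /distr_fun beval_mono. Qed.

End Distribution.

(* Stable under multiplication by B on both sides; units are not required. *)
Definition star_subalgebra_over (S : set N) :=
  [/\ S 0,
      forall (a : K) m m', S m -> S m' -> S (a *: m + m'),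
      forall m m', S m -> S m' -> S (m * m'),
      forall b b' m, S m -> S (ncincl N b * m * ncincl N b')
    & forall m, S m -> S (star m)].

Definition generated_over (Z : N) : set N :=
  [set m | forall S : set N, star_subalgebra_over S -> S Z -> S m].

Definition with_scalars (S : set N) : set N :=
  [set x | exists b m, S m /\ x = ncincl N b + m].

(* b_0 X_1 b_1 ... X_n b_n, with X_i stored as X (i - 1); the first and last
   factors may have a component in B. *)
Definition boolean_independent (I : Type) (S : I -> set N) :=
  forall (n : nat) (j : nat -> I) (X : nat -> N) (b : nat -> B),
    (0 < n)%N ->
    (forall i, (i.+1 < n)%N -> j i <> j i.+1) ->
    (forall i, (0 < i < n.-1)%N -> S (j i) (X i)) ->
    with_scalars (S (j 0)) (X 0) ->
    with_scalars (S (j n.-1)) (X n.-1) ->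
    ncE (ncincl N (b 0) * \prod_(0 <= i < n) (X i * ncincl N (b i.+1)))
    = b 0 * \prod_(0 <= i < n) (ncE (X i) * b i.+1).

Definition boolean_independent_pair (Z1 Z2 : N) :=
  boolean_independent (fun i : bool => generated_over (if i then Z1 else Z2)).

Definition nc_var (Q : N) (b : B) : B :=
  ncE ((1 + star Q) * ncincl N b * (1 + Q))
  - ncE (1 + star Q) * b * ncE (1 + Q).

End NCPS.

Arguments ncE {K B n}.

(* Main.v *)
Require Import Defs.
From HB Require Import structures.
From mathcomp Require Import all_boot all_order all_algebra.
From mathcomp Require Import boolp classical_sets reals.
From mathcomp Require Import complex.
From mathcomp Require Import zify.

(** Put [q b = (1 + Q^* ) b (1 + Q) - b]. In the word
      [T b_1 T ... b_n T = (1 + Q) Y (1 + Q^* ) b_1 (1 + Q) Y ... Y (1 + Q^* )]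
    every inner factor [(1 + Q^* ) b_i (1 + Q)] is [b_i + q b_i]. Expanding
    the sum, the positions where [q b_i] is chosen cut the word into blocks
    [Y b Y ... b' Y], so each term is a word that alternates between the
    algebra of [Q] (the elements [q b_i]) and the algebra of [Y] (the blocks),
    with [1 + Q] and [1 + Q^* ] at its two ends. Boolean independence, which
    admits scalar components at the ends only, factors the expectation of each
    term. The variance condition says exactly that
      [E (q b) = (1 + e^* ) b (1 + e)],
    so each block [m = E (Y b Y ... b' Y)] ends up surrounded by [1 + e] and
    [1 + e^* ], that is, replaced by [alpha m]. The sum over the choices is then
    the Boolean moment-cumulant formula, which says that [T] has B-transform
    [alpha] applied to the moment series of [Y], as claimed.

    The choices are not enumerated below: everything goes through the recursion
    on the first chosen position, for words ([tail_word_rec]), for expectations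
    ([alternating_factor], [alternating_rec]) and for the Boolean sum
    ([bool_sum_unique]). *)

Set Implicit Arguments.
Unset Strict Implicit.
Unset Printing Implicit Defensive.

Import Order.TTheory GRing.Theory Num.Theory.

Local Open Scope ring_scope.

(** * The expectation and the involution *)

Section Expectation.
Variables (K : numClosedFieldType) (B : starAlgType K) (N : ncps B).

Lemma star_nonneg (x : B) : nonneg x -> star x = x.
Proof. by case=> c ->; rewrite starM starK. Qed.

(** Expand the positive element [E ((1 + m)^* (1 + m))]: its other two terms are
    self-adjoint. *)
Lemma ncE_polar_selfadjoint (m : N) :
  star (ncE m + ncE (star m)) = ncE m + ncE (star m).
Proof.
have sa (x : N) := star_nonneg (ncE_positive x).
have := sa (1 + m); rewrite starD star1 mulrDl !mulrDr !mul1r !mulr1 !linearD /=.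
rewrite !starD sa ncE_unit star1 -[X in X = _]addrA -[X in _ = X]addrA => /addrI.
by rewrite !addrA => /addIr.
Qed.

(** Positivity makes [E m + E (m^* )] self-adjoint; applying this to [m] and to
    ['i m] separates [E m] from [E (m^* )]. *)
Lemma ncE_star (m : N) : ncE (star m) = star (ncE m).
Proof.
have re := ncE_polar_selfadjoint m.
have im := ncE_polar_selfadjoint ('i *: m).
rewrite starZ !linearZ /= conjCi scaleNr starD starN !starZ conjCi in im.
rewrite !scaleNr opprK in im.
have {}im : star (ncE (star m)) - star (ncE m) = ncE m - ncE (star m).
  by apply: (scalerI (neq0Ci K)); rewrite !scalerBr -im addrC.
apply: (canRL (@starK _ _)); apply: (@scalerI _ _ (2%:R : K)).
  by rewrite pnatr_eq0.
rewrite starD [RHS]addrC in re; rewrite !scaler_nat !mulr2n.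
by have := congr2 +%R im re; rewrite addrA subrK addrA subrK.
Qed.

End Expectation.

(** * Words and their expansion into blocks *)

Section Words.
Variables (K : numClosedFieldType) (B : starAlgType K) (N : ncps B).

(** The image of [xword] under the substitution of [Z] for the variable. *)
Definition nc_word (Z : N) (bs : seq B) : N :=
  Z * \prod_(b <- bs) (ncincl N b * Z).

Lemma moment_series_distr (Z : N) bs :
  moment_series (distr Z) bs = ncE (nc_word Z bs).
Proof.
rewrite /= /xword rmorphM rmorph_prod /= bevalX; congr (ncE (_ * _)).
by apply: eq_bigr => b _; rewrite rmorphM /= bevalC bevalX.
Qed.

Lemma nc_word_cons Z b bs : nc_word Z (b :: bs) = Z * ncincl N b * nc_word Z bs.
Proof. by rewrite /nc_word big_cons !mulrA. Qed.

(** What follows the first factor [1 + Q] in a word in [(1 + Q) Y (1 + Q^* )],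
    each inner product being split into its scalar and the rest; see
    [nc_word_sandwich]. *)
Definition tail_word (Y z : N) (q : B -> N) (bs : seq B) : N :=
  Y * \prod_(b <- bs) ((ncincl N b + q b) * Y) * z.

Lemma tail_word_cons Y z q b bs : tail_word Y z q (b :: bs) =
  Y * ncincl N b * tail_word Y z q bs + Y * q b * tail_word Y z q bs.
Proof. by rewrite /tail_word big_cons -mulrDl -mulrDr !mulrA. Qed.

(** Classifies the terms of the expanded product by the first [i] for which
    [q b_i] is chosen. *)
Lemma tail_word_rec Y z q bs : tail_word Y z q bs =
  nc_word Y bs * z +
  \sum_(0 <= i < size bs)
     nc_word Y (take i bs) * q bs`_i * tail_word Y z q (drop i.+1 bs).
Proof.
elim: bs => [|b bs IH].
  by rewrite /tail_word /nc_word !big_nil addr0.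
rewrite tail_word_cons /= big_nat_recl //= drop0.
rewrite [in Y * ncincl N b * _]IH mulrDr mulr_sumr nc_word_cons.
rewrite !mulrA -addrA; congr (_ + _); rewrite addrC; congr (_ + _).
  by rewrite /nc_word big_nil mulr1.
by apply: eq_bigr => i _; rewrite nc_word_cons !mulrA.
Qed.

(** Substituting [P Y P^* ] for [Y] amounts to inserting [P^* b P] between
    consecutive letters [Y]. *)
Lemma nc_word_sandwich (P Y : N) bs :
  nc_word (P * Y * star P) bs =
  P * tail_word Y (star P) (fun b => star P * ncincl N b * P - ncincl N b) bs.
Proof.
elim: bs => [|b bs IH].
  by rewrite /nc_word /tail_word !big_nil !mulr1 !mulrA.
by rewrite nc_word_cons IH tail_word_cons -mulrDl -mulrDr subrKC !mulrA.
Qed.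

End Words.

(** * Boolean independence and alternating words *)

Section Alternation.
Variables (K : numClosedFieldType) (B : starAlgType K) (N : ncps B).

(** Alternating words serve as prefixes, to be continued by a letter of [S false]. Their
    last letter thus becomes an inner one, which is why only the first letter may
    have a scalar part. *)
Definition alternating (S : bool -> set N) (s : seq N) :=
  odd (size s) /\ forall i, (i < size s)%N ->
    if i is 0 then with_scalars (S true) s`_0 else S (~~ odd i) s`_i.

Lemma alternating_cat S s y a : alternating S s -> S false y -> S true a ->
  alternating S (s ++ [:: y; a]).
Proof.
move=> [s_odd sS] Sy Sa; split=> [|i].
  by rewrite size_cat addn2 /= negbK.
rewrite size_cat addn2 => hi.
have [his|his] := ltnP i (size s).
  by have := sS i his; case: i his {hi} => [|i] his; rewrite nth_cat his.
case: i hi his => [|i] hi his; first by case: (s) s_odd his.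
rewrite nth_cat ltnNge his.
have [e|e] : (i.+1 = size s \/ i.+1 = (size s).+1)%N by lia.
  by rewrite e subnn s_odd.
by rewrite e subSn // subnn /= s_odd.
Qed.

Variable S : bool -> set N.
Hypothesis indep : boolean_independent S.

Lemma alternating_expectation s y z :
  alternating S s -> S false y -> with_scalars (S true) z ->
  ncE (\prod_(x <- s) x * y * z) = \prod_(x <- s) ncE x * ncE y * ncE z.
Proof.
move=> [s_odd sS] Sy Sz.
have s0 : (0 < size s)%N by case: (s) s_odd.
pose t := s ++ [:: y; z].
have st : size t = (size s).+2 by rewrite size_cat addn2.
suff: ncE (\prod_(0 <= i < size t) t`_i) = \prod_(0 <= i < size t) ncE t`_i.
  rewrite -(big_nth 0 xpredT id) -(big_nth 0 xpredT (fun x => ncE x)).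
  by rewrite !big_cat !big_cons !big_nil /= !mulr1 !mulrA.
transitivity (ncE (ncincl N 1 * \prod_(0 <= i < size t) (t`_i * ncincl N 1))).
  rewrite rmorph1 mul1r; congr (ncE _).
  by apply: eq_bigr => i _; rewrite mulr1.
rewrite (@indep (size t) (fun i => ~~ odd i) (nth 0 t) (fun=> 1)).
- by rewrite mul1r; apply: eq_bigr => i _; rewrite mulr1.
- by rewrite st.
- by move=> i _ /=; case: (odd i).
- move=> i /andP[i0 hi]; rewrite nth_cat.
  have [his|his] := ltnP; first by have := sS i his; case: (i) i0.
  have -> : i = size s by apply: anti_leq; rewrite his andbT; rewrite st in hi.
  by rewrite subnn s_odd.
- by rewrite nth_cat s0; exact: (sS 0 s0).
- by rewrite st /= negbK s_odd nth_cat ltnNge leqnSn /= subSn // subnn.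
Qed.

Hypothesis S0 : S true 0.

Lemma alternating1 : alternating S [:: 1].
Proof.
split=> // -[|//] _; exists 1, 0.
by rewrite rmorph1 addr0.
Qed.

(** The words [r bs] below are sums of alternating words, in the recursive form
    of [tail_word_rec]. *)
Variables (y : seq B -> N) (q : B -> N) (z : N) (r : seq B -> N).
Hypotheses (Sy : forall bs, S false (y bs)) (Sq : forall b, S true (q b)).
Hypothesis Sz : with_scalars (S true) z.
Hypothesis rE : forall bs, r bs = y bs * z +
  \sum_(0 <= i < size bs) y (take i bs) * q bs`_i * r (drop i.+1 bs).

(** The prefix [s] is arbitrary so that the induction on [bs] can move the first
    block of [r bs] into it. The recursion for [ncE (r bs)] is proved along with
    the factorization, being the case of the prefix [1] of the computation. *)
Lemma alternating_factor_rec bs :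
  (forall s, alternating S s ->
     ncE (\prod_(x <- s) x * r bs) = \prod_(x <- s) ncE x * ncE (r bs)) /\
  ncE (r bs) = ncE (y bs) * ncE z + \sum_(0 <= i < size bs)
     ncE (y (take i bs)) * ncE (q bs`_i) * ncE (r (drop i.+1 bs)).
Proof.
have [k] := ubnP (size bs); elim: k bs => // k IH bs hk.
set g := (X in _ /\ _ = X).
have fac s : alternating S s ->
    ncE (\prod_(x <- s) x * r bs) = \prod_(x <- s) ncE x * g.
  move=> alt_s; rewrite rE mulrDr mulrA linearD /= alternating_expectation //.
  rewrite /g mulrDr !mulrA; congr (_ + _).
  rewrite !mulr_sumr linear_sum /=; apply: eq_big_nat => i /andP[_ hi].
  have [|h _] := IH (drop i.+1 bs); first by rewrite size_drop; lia.
  have := h _ (alternating_cat alt_s (Sy (take i bs)) (Sq bs`_i)).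
  by rewrite !big_cat !big_cons !big_nil /= !mulr1 !mulrA.
have gE : ncE (r bs) = g.
  by have := fac _ alternating1; rewrite !big_seq1 ncE_unit !mul1r.
by split=> // s alt_s; rewrite gE fac.
Qed.

Lemma alternating_factor a bs : with_scalars (S true) a ->
  ncE (a * r bs) = ncE a * ncE (r bs).
Proof.
move=> Sa; have := (alternating_factor_rec bs).1 [:: a].
by rewrite !big_seq1; apply; split=> // -[|].
Qed.

Lemma alternating_rec bs :
  ncE (r bs) = ncE (y bs) * ncE z + \sum_(0 <= i < size bs)
     ncE (y (take i bs)) * ncE (q bs`_i) * ncE (r (drop i.+1 bs)).
Proof. exact: (alternating_factor_rec bs).2. Qed.

End Alternation.

(** * Generated subalgebras *)

Section Generated.
Variables (K : numClosedFieldType) (B : starAlgType K) (N : ncps B).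

Lemma generated_over_subalgebra (Z : N) : star_subalgebra_over (generated_over Z).
Proof.
split=> [S|a m m' hm hm' S|m m' hm hm' S|b b' m hm S|m hm S] hS SZ.
- by case: hS.
- by case: (hS) => _ h _ _ _; apply: h; [exact: hm|exact: hm'].
- by case: (hS) => _ _ h _ _; apply: h; [exact: hm|exact: hm'].
- by case: (hS) => _ _ _ h _; apply: h; exact: hm.
- by case: (hS) => _ _ _ _ h; apply: h; exact: hm.
Qed.

Section Subalgebra.
Variable S : set N.
Hypothesis S_sub : star_subalgebra_over S.

Lemma subalgebra_add m m' : S m -> S m' -> S (m + m').
Proof. by case: S_sub => _ h _ _ _ Sm Sm'; have := h 1 _ _ Sm Sm'; rewrite scale1r. Qed.

Lemma subalgebra_mull b m : S m -> S (ncincl N b * m).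
Proof. by case: S_sub => _ _ _ h _ /(h b 1); rewrite rmorph1 mulr1. Qed.

Lemma subalgebra_mulr b m : S m -> S (m * ncincl N b).
Proof. by case: S_sub => _ _ _ h _ /(h 1 b); rewrite rmorph1 mul1r. Qed.

Lemma with_scalars_add1 m : S m -> with_scalars S (1 + m).
Proof. by exists 1, m; rewrite rmorph1. Qed.

Lemma subalgebra_word Z bs : S Z -> S (nc_word Z bs).
Proof.
move=> SZ; elim: bs => [|b bs IH]; first by rewrite /nc_word big_nil mulr1.
rewrite nc_word_cons; case: (S_sub) => _ _ SM _ _.
exact: SM (subalgebra_mulr _ SZ) IH.
Qed.

(** The scalar [b] cancels, which leaves terms with a factor [Q] or [star Q]. *)
Lemma subalgebra_sandwich Q b : S Q ->
  S ((1 + star Q) * ncincl N b * (1 + Q) - ncincl N b).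
Proof.
move=> SQ; have SQs : S (star Q) by case: S_sub => _ _ _ _; exact.
have -> : (1 + star Q) * ncincl N b * (1 + Q) - ncincl N b =
    ncincl N b * Q + (star Q * ncincl N b + star Q * (ncincl N b * Q)).
  apply: (canLR (addrK _)); rewrite [RHS]addrC mulrDr mulr1 !mulrDl !mul1r.
  by rewrite -addrA; congr (_ + _); rewrite addrCA !mulrA.
have SbQ := subalgebra_mull b SQ.
apply: subalgebra_add => //; apply: subalgebra_add; first exact: subalgebra_mulr.
by case: S_sub => _ _ SM _ _; exact: SM.
Qed.

End Subalgebra.

End Generated.

(** * The Boolean sum and the Boolean power *)

Section Cumulants.
Variables (K : numClosedFieldType) (B : starAlgType K).

(** [bool_sumE], the expansion along the first block, determines the sum. *)
Lemma bool_sum_unique (F G : seq B -> B) :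
  (forall bs, G bs = F bs + conv F G bs) -> G =1 bool_sum F.
Proof.
move=> GE bs; have [k] := ubnP (size bs); elim: k bs => // k IH bs hk.
rewrite GE bool_sumE; congr (_ + _); apply: eq_big_nat => i /andP[_ hi].
by rewrite IH // size_drop; lia.
Qed.

Lemma eq_boolean_power (mu nu : Sigma_alg B) (alpha : {linear B -> B}) :
  (forall bs, moment_series nu bs = bool_sum (alpha \o B_transform mu) bs) ->
  nu = boolean_power mu alpha.
Proof.
move=> h; apply: (bij_inj (@B_transform_bij K B)); rewrite boolean_powerP.
exact/esym/B_transform_unique.
Qed.

End Cumulants.

(** * The distribution of (1 + Q) Y (1 + Q^* ) *)

Theorem theorem9p6 (R : realType) (B : cstarAlgType R)
  (mu : Sigma_alg B) (mu_poisson : boolean_compound_poisson mu)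
  (alpha : {linear B -> B}) (alpha_cp : completely_positive alpha)
  (e : B) (alphaE : forall b, alpha b = (1 + e) * b * (1 + star e))
  (N : ncps B)
  (Y : N) (Y0 : nc0 Y) (Y_sa : star Y = Y)
  (MY : moment_series (distr Y) = B_transform mu)
  (Q : N) (Q0 : nc0 Q) (QY : boolean_independent_pair Q Y)
  (EQ : ncE Q = e) (VarQ : forall b, nc_var Q b = b) :
  distr ((1 + Q) * Y * (1 + star Q)) = boolean_power mu alpha.
Proof.
pose q b := star (1 + Q) * ncincl N b * (1 + Q) - ncincl N b.
have P_star : star (1 + Q) = 1 + star Q by rewrite starD star1.
have EP : ncE (1 + Q) = 1 + e by rewrite linearD /= ncE_unit EQ.
have EPs : ncE (star (1 + Q)) = 1 + star e by rewrite ncE_star EP starD star1.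
have Eq b : ncE (q b) = (1 + star e) * b * (1 + e).
  have := VarQ b; rewrite /nc_var -P_star EPs EP => /(canRL (subrK _)) Eb.
  by rewrite /q linearB /= ncEC Eb addrC addKr.
have [subQ subY] := (generated_over_subalgebra Q, generated_over_subalgebra Y).
have [Qself Yself] : generated_over Q Q /\ generated_over Y Y by split=> ?.
have Y_words bs : generated_over Y (nc_word Y bs).
  exact (subalgebra_word subY bs Yself).
have Q_inner b : generated_over Q (q b).
  by rewrite /q P_star; exact (subalgebra_sandwich subQ b Qself).
have Q_zero : generated_over Q 0 by case: subQ.
have Q_first : with_scalars (generated_over Q) (1 + Q).
  exact (with_scalars_add1 Qself).
have Q_last : with_scalars (generated_over Q) (star (1 + Q)).
  rewrite P_star; apply: with_scalars_add1.
  by case: subQ => _ _ _ _; apply; exact: Qself.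
have tail_rec := tail_word_rec Y (star (1 + Q)) q.
apply: eq_boolean_power => bs; rewrite moment_series_distr -P_star.
rewrite nc_word_sandwich -/q.
rewrite (alternating_factor QY Q_zero Y_words Q_inner Q_last tail_rec) //.
move: bs; apply: bool_sum_unique => bs.
rewrite (alternating_rec QY Q_zero Y_words Q_inner Q_last tail_rec).
have MYE cs : B_transform mu cs = ncE (nc_word Y cs).
  by rewrite -MY moment_series_distr.
rewrite EP EPs mulrDr mulr_sumr /= alphaE MYE mulrA.
congr (_ + _); apply: eq_big_nat => i _ /=.
by rewrite Eq alphaE MYE !mulrA.
Qed.
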